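(* Let $k\ge 1$, let $a_1,\ldots,a_k$ be nonnegative integers and let $n=a_1+\cdots+a_k$. Then, as polynomials in $\lambda$, $$\frac{1}{a_1!\cdots a_k!}\sum_{T\subseteq\{1,\ldots,n\}}(-1)^{|T|} f_\lambda(|\{1,\ldots,n\}\setminus T|)\prod_{i=1}^k f_\lambda(|A_i\cap T|)=\frac{1}{a_1!\cdots a_k!}\sum_{\pi\in S_n}c(\pi),$$ where $S_n$ is the symmetric group on $\{1,\ldots,n\}$. In particular, the left-hand side does not depend on $\lambda$, and the right-hand side is the number of $(a_1,\ldots,a_k)$-descending derangements.
   Context: Partition $\{1,\ldots,n\}$ into consecutive blocks $A_1,\ldots,A_k$ (in this order) with $|A_i|=a_i$, i.e. $A_i=\{a_1+\cdots+a_{i-1}+1,\ldots,a_1+\cdots+a_i\}$. For $m\ge 0$, $f_\lambda(m)$ denotes the generating function, in the variable $\lambda$, for permutations of $\{1,\ldots,m\}$ by number of fixed points: the coefficient of $\lambda^j$ in $f_\lambda(m)$ is the number of permutations in $S_m$ with exactly $j$ fixed points (so $f_\lambda(0)=1$, $f_\lambda(1)=\lambda$, $f_\lambda(2)=1+\lambda^2$). A cycle of a permutation $\pi\in S_n$ (in its disjoint cycle decomposition, fixed points being cycles of length $1$) is called small if it lies entirely within one of the blocks $A_i$. Define $c(\pi)=0$ if $\pi$ contains any small cycle of odd length, and $c(\pi)=2^m$ otherwise, where $m$ is the number of small cycles of $\pi$. An $(a_1,\ldots,a_k)$-descending derangement is a permutation $\pi$ of $\{1,\ldots,n\}$ with no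 fixed points such that $\pi(j)>\pi(j+1)$ whenever $j,j+1$ lie in the same block $A_i$. *)

(* Defs.v *)
(* The index set {1,..,n} is rendered as 'I_n = {0,..,n-1}. *)
From HB Require Import structures.
From mathcomp Require Import all_boot all_order all_algebra all_fingroup.

Set Implicit Arguments.
Unset Strict Implicit.
Unset Printing Implicit Defensive.

Import GRing.Theory.
Local Open Scope ring_scope.

Definition fixpts (n : nat) (s : 'S_n) : {set 'I_n} := [set x | s x == x].

Definition f_lambda (m : nat) : {poly rat} :=
  \poly_(j < m.+1) (#|[set s : 'S_m | #|fixpts s| == j]|)%:R.

(* Shifted to start at 0: the block with index i is the interval
   [a_0 + .. + a_(i-1), a_0 + .. + a_i). *)
Definition block (n k : nat) (a : 'I_k -> nat) (i : 'I_k) : {set 'I_n} :=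
  [set x : 'I_n | (\sum_(l < k | (l < i)%N) a l <= x
                     < \sum_(l < k | (l <= i)%N) a l)%N].

(* A cycle of s is identified with its support, an element of [porbits s]
   (fixed points give singletons). *)
Definition small_cycles (n k : nat) (a : 'I_k -> nat) (s : 'S_n) :
    {set {set 'I_n}} :=
  [set C in porbits s | [exists i : 'I_k, C \subset block n a i]].

Definition cweight (n k : nat) (a : 'I_k -> nat) (s : 'S_n) : nat :=
  if [exists C in small_cycles a s, odd #|C|] then 0%N
  else (2 ^ #|small_cycles a s|)%N.

Definition descending_derangement (n k : nat) (a : 'I_k -> nat) (s : 'S_n) :
    bool :=
  [forall x : 'I_n, s x != x] &&
  [forall i : 'I_k, forall x in block n a i, forall y in block n a i,
     (val y == (val x).+1) ==> (s y < s x)%N].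

(* Main.v *)
Require Import Defs.
From HB Require Import structures.
From mathcomp Require Import all_boot all_order all_algebra all_fingroup.
From mathcomp Require Import zify ring.

(** The first identity is a double count.  For a set [T], the product of the
    [f_lambda]'s enumerates, by fixed points, the permutations [s] that
    preserve the complement of [T] and each [A_i :&: T]
    ([prod_f_lambda_color]); these are the [s] for which [T] is a union of
    small cycles.  Exchanging the two sums, [s] receives the weight
    [X^fix(s) * \prod_C (1 + (-1)^|C|)] over its small cycles [C]
    ([sum_sets_f_lambda]).  A small cycle of odd length kills this product; a
    fixed point is such a cycle, so the surviving terms carry no [X] at all and
    equal [cweight].

    For the second identity the first one is read at [X = 1], where [f_lambda m]
    becomes [m!].  With the linear functional [fact_lin : 'X^m |-> m!] the sum
    over [T] factors over the blocks, and the result is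
    [\prod_i (a_i)! * fact_lin (\prod_i desc_poly (a_i))], where
    [desc_poly c = \sum_(j <= c) (-1)^(c - j) X^j / j!]
    ([sum_cweight_fact_lin]).

    It remains to see that [fact_lin (\prod_i desc_poly (a_i))] counts the
    descending derangements. A permutation descending on blocks is
    determined by the word that records, for each value, the block of its
    position; every word with [a_i] letters [i] arises. Let [j] be a letter.
    In a block at most one point is fixed, and the key observation is that a
    word without a fixed point in block [j] has exactly one place where a
    further letter [j] can be inserted so as to become a fixed point, and
    that this insertion leaves the fixed points in the other blocks alone
    ([word_gap_exists], [has_word_fix_insert_at]). So, with conditions
    imposed on some of the other blocks, a word content [a] has as many
    words with a fixed point in block [j] as the content [a] with one [j]
    less has words without one ([nofix_count_step]). This is the recurrence
    [desc_poly c.+1 = X^(c.+1) / (c.+1)! - desc_poly c], and without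
    conditions the number of words is the multinomial coefficient [fact_lin
    (\prod_i X^(a_i) / (a_i)!)] ([nofix_countE]). *)

Set Implicit Arguments.
Unset Strict Implicit.
Unset Printing Implicit Defensive.

Import GRing.Theory.

(** * Fixed points in words *)

Definition occ (i : nat) (t : seq nat) : nat := count_mem i t.

Definition occ_lt (i : nat) (t : seq nat) : nat := count (gtn i) t.

(** The word [t] encodes the permutation that sends the [m]-th smallest position
    of block [i] to the [m]-th largest index carrying the letter [i].  An index
    [x] with letter [i] is then the value at the position
    [occ i (drop x.+1 t) + occ_lt i t]: block [i] starts at [occ_lt i t], and
    its positions take the larger values first. *)
Definition word_fix (i : nat) (t : seq nat) (x : nat) : bool :=
  [&& x < size t, nth 0 t x == i
    & occ i (drop x.+1 t) + occ_lt i t == x].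

Definition has_word_fix (i : nat) (t : seq nat) : bool :=
  has (word_fix i t) (iota 0 (size t)).

(** The condition on [x] under which a letter [i] inserted at [x] is a fixed
    point: see [word_fix_insert_at]. *)
Definition word_gap (i : nat) (t : seq nat) (x : nat) : bool :=
  (x <= size t) && (occ i (drop x t) + occ_lt i t == x).

Definition insert_at (x i : nat) (t : seq nat) : seq nat :=
  take x t ++ i :: drop x t.

Lemma has_word_fixP i t :
  reflect (exists x, word_fix i t x) (has_word_fix i t).
Proof.
apply: (iffP hasP) => [[x _ fx]|[x fx]]; exists x => //.
by rewrite mem_iota; case/andP: fx.
Qed.

Lemma leq_occ_drop i (t : seq nat) x y :
  x <= y -> occ i (drop y t) <= occ i (drop x t).
Proof.
move=> le_xy; rewrite /occ -(subnK le_xy) -drop_drop.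
by rewrite -{2}(cat_take_drop (y - x) (drop x t)) count_cat leq_addl.
Qed.

Lemma occ_drop_nth (t : seq nat) i x :
  x < size t ->
  occ i (drop x t) = (nth 0 t x == i) + occ i (drop x.+1 t).
Proof. by move=> lt_xt; rewrite /occ (drop_nth 0). Qed.

Lemma occ_ltD i j (t : seq nat) :
  i < j -> occ_lt i t + occ i t <= occ_lt j t.
Proof. by move=> lt_ij; rewrite /occ_lt /occ; elim: t => //= l t IH; lia. Qed.

Lemma word_fix_bounds i t x : word_fix i t x ->
  occ_lt i t <= x < occ_lt i t + occ i t.
Proof.
case/and3P=> lt_xt nth_x /eqP def_x.
have := leq_occ_drop i t (leq0n x).
rewrite drop0 (occ_drop_nth i lt_xt) nth_x; lia.
Qed.

Lemma word_gap_bounds i t x : word_gap i t x ->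
  occ_lt i t <= x <= occ_lt i t + occ i t.
Proof.
case/andP=> _ /eqP def_x.
by have := leq_occ_drop i t (leq0n x); rewrite drop0; lia.
Qed.

(** In the equation defining a fixed point the left side does not increase with
    [x], while the right side does. *)
Lemma word_fix_inj i t x y : word_fix i t x -> word_fix i t y -> x = y.
Proof.
wlog le_xy: x y / x <= y.
  by move=> W fx fy; case/orP: (leq_total x y) => le; [|symmetry]; apply: W.
case/and3P=> _ _ /eqP def_x /and3P[_ _ /eqP def_y].
by have := @leq_occ_drop i t x.+1 y.+1 le_xy; lia.
Qed.

Lemma word_gap_inj i t x y : word_gap i t x -> word_gap i t y -> x = y.
Proof.
wlog le_xy: x y / x <= y.
  by move=> W fx fy; case/orP: (leq_total x y) => le; [|symmetry]; apply: W.
case/andP=> _ /eqP def_x /andP[_ /eqP def_y].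
by have := @leq_occ_drop i t x y le_xy; lia.
Qed.

(** At a fixed point [p], the nonincreasing quantity
    [occ i (drop x t) + occ_lt i t] falls from [p + 1] at [x = p] to [p] at
    [x = p + 1], so it never equals [x]. *)
Lemma word_gap_nofix i t x : word_gap i t x -> ~~ has_word_fix i t.
Proof.
case/andP=> _ /eqP def_x; apply/has_word_fixP=> -[p /and3P[lt_pt nth_p /eqP]].
move=> def_p; have := occ_drop_nth i lt_pt; rewrite nth_p.
case: (leqP x p) => [le_xp|lt_px].
  by have := leq_occ_drop i t le_xp; lia.
by have := leq_occ_drop i t lt_px; lia.
Qed.

(** A discrete intermediate value argument: as [x] grows, the quantity
    [occ i (drop x t) + occ_lt i t] drops by at most one at each step, so it
    meets the diagonal unless it crosses it between some [x] and [x + 1]; such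
    a crossing is a fixed point. *)
Lemma word_gap_exists i t : ~~ has_word_fix i t -> exists x, word_gap i t x.
Proof.
move=> nofix.
have ex_x : exists x, occ i (drop x t) + occ_lt i t <= x.
  by exists (size t); rewrite drop_size; apply: count_size.
case: (ex_minnP ex_x) => x le_x min_x; exists x.
have le_xt : x <= size t by apply: min_x; rewrite drop_size; apply: count_size.
rewrite /word_gap le_xt eqn_leq le_x /= leqNgt; apply/negP=> gt_x.
case: x => [//|x] in le_x min_x le_xt gt_x *.
case/has_word_fixP: nofix; exists x.
have := occ_drop_nth i le_xt; have : ~~ (occ i (drop x t) + occ_lt i t <= x).
  by apply/negP=> /min_x; rewrite ltnn.
rewrite /word_fix le_xt /=; case: (_ == i) => /=; lia.
Qed.

Lemma count_insert_at p x i t : count p (insert_at x i t) = p i + count p t.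
Proof.
by rewrite -[in RHS](cat_take_drop x t) /insert_at !count_cat /=; lia.
Qed.

Lemma occ_insert_at x i j t :
  occ j (insert_at x i t) = (i == j) + occ j t.
Proof. exact: count_insert_at. Qed.

Lemma occ_lt_insert_at x i j t :
  occ_lt j (insert_at x i t) = (i < j) + occ_lt j t.
Proof. exact: count_insert_at. Qed.

Lemma perm_insert_at x i t : perm_eq (insert_at x i t) (i :: t).
Proof. by apply/seq.permP=> p; rewrite count_insert_at. Qed.

Lemma size_insert_at x i t : size (insert_at x i t) = (size t).+1.
Proof. exact: perm_size (perm_insert_at x i t). Qed.

Lemma drop_insert_at_gt x i t p :
  x <= p -> x <= size t -> drop p.+1 (insert_at x i t) = drop p t.
Proof.
move=> le_xp le_xt; rewrite /insert_at drop_cat size_takel // ltnNge leqW //=.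
by rewrite subSn //= drop_drop subnK.
Qed.

Lemma drop_insert_at_le x i t p :
  p <= x -> x <= size t ->
  drop p (insert_at x i t) = insert_at (x - p) i (drop p t).
Proof.
move=> le_px le_xt; rewrite /insert_at drop_cat size_takel //.
case: ltngtP le_px => // [lt_px|->] _; last by rewrite subnn take0 !drop0.
by rewrite take_drop drop_drop subnK // ltnW.
Qed.

Lemma nth_insert_at x i t p : x <= size t ->
  nth 0 (insert_at x i t) p =
  if p < x then nth 0 t p else if p == x then i else nth 0 t p.-1.
Proof.
move=> le_xt; rewrite /insert_at nth_cat size_takel //.
case: ltngtP => [lt|gt|->]; last by rewrite subnn.
  by rewrite nth_take.
by case: p gt => // p gt; rewrite subSn //= nth_drop addnC subnK.
Qed.

Lemma word_fix_insert_at i t x :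
  x <= size t -> word_fix i (insert_at x i t) x = word_gap i t x.
Proof.
move=> le_xt; rewrite /word_fix /word_gap size_insert_at ltnS le_xt.
rewrite nth_insert_at // ltnn !eqxx drop_insert_at_gt //.
by rewrite occ_lt_insert_at ltnn add0n.
Qed.

(** Fixed points in block [j] lie in the interval of positions of block [j], and
    a gap for [i] lies in the closed interval spanned by block [i].  Hence the
    insertion happens wholly before the fixed point, shifting both it and the
    start of block [j] by one, or wholly after it. *)
Lemma has_word_fix_insert_at (i j : nat) t x : j != i -> word_gap i t x ->
  has_word_fix j (insert_at x i t) = has_word_fix j t.
Proof.
move=> ne_ji gx; have /andP[le_xt _] := gx; have bx := word_gap_bounds gx.
apply/has_word_fixP/has_word_fixP=> -[p fp].
  have := word_fix_bounds fp; rewrite occ_insert_at occ_lt_insert_at => bp.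
  case/and3P: fp; rewrite size_insert_at nth_insert_at // occ_lt_insert_at.
  move=> lt_pt; case: (ltngtP i j) ne_ji => // lt_ij _.
    have Hc := occ_ltD t lt_ij.
    case: p => [|p] in bp lt_pt *; first by lia.
    have [-> ->] : (p.+1 < x) = false /\ (p.+1 == x) = false by split; lia.
    move=> nth_p; rewrite drop_insert_at_gt; [|lia|by []].
    by move=> def_p; exists p; apply/and3P; split=> //; lia.
  have Hc := occ_ltD t lt_ij.
  have -> : p < x by lia.
  move=> nth_p; rewrite drop_insert_at_le; [|lia|by []].
  rewrite occ_insert_at => def_p.
  by exists p; apply/and3P; split=> //; lia.
have := word_fix_bounds fp => bp.
case/and3P: fp => lt_pt nth_p def_p.
case: (ltngtP i j) ne_ji => // lt_ij _; have := occ_ltD t lt_ij => Hc.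
  exists p.+1; rewrite /word_fix size_insert_at ltnS lt_pt nth_insert_at //.
  have -> : p.+1 < x = false by lia.
  have -> : p.+1 == x = false by lia.
  rewrite nth_p drop_insert_at_gt; [|lia|by []].
  by rewrite occ_lt_insert_at; lia.
exists p; rewrite /word_fix size_insert_at ltnS nth_insert_at //.
have -> : p < x by lia.
rewrite nth_p drop_insert_at_le; [|lia|by []].
by rewrite occ_insert_at occ_lt_insert_at; lia.
Qed.

Definition the_gap i t := find (word_gap i t) (iota 0 (size t).+1).

Lemma the_gapP i t : ~~ has_word_fix i t -> word_gap i t (the_gap i t).
Proof.
case/word_gap_exists=> x gx.
have hx : has (word_gap i t) (iota 0 (size t).+1).
  by apply/hasP; exists x; rewrite // mem_iota ltnS; case/andP: gx.
have := nth_find 0 hx; rewrite nth_iota //.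
by move: hx; rewrite has_find size_iota.
Qed.

Definition nofix_below r t := all (fun j => ~~ has_word_fix j t) (iota 0 r).

Definition nofix_count r s := count (nofix_below r) (permutations s).

Lemma nofix_belowS r t :
  nofix_below r.+1 t = nofix_below r t && ~~ has_word_fix r t.
Proof. by rewrite /nofix_below -addn1 iotaD all_cat /= andbT. Qed.

Lemma nofix_below_insert_at r t x :
  word_gap r t x -> nofix_below r (insert_at x r t) = nofix_below r t.
Proof.
move=> gx; apply: eq_in_all => j; rewrite mem_iota /= => lt_jr.
by rewrite has_word_fix_insert_at // ltn_eqF.
Qed.

Lemma insert_atK x i t : x <= size t ->
  take x (insert_at x i t) ++ drop x.+1 (insert_at x i t) = t.
Proof.
move=> le_xt; rewrite drop_insert_at_gt // /insert_at take_cat size_takel //.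
by rewrite ltnn subnn take0 cats0 cat_take_drop.
Qed.

Lemma insert_at_remove i t x :
  x < size t -> nth 0 t x = i ->
  insert_at x i (take x t ++ drop x.+1 t) = t.
Proof.
move=> lt_xt <-; have szx : size (take x t) = x by rewrite size_takel // ltnW.
rewrite /insert_at take_cat drop_cat szx ltnn subnn take0 drop0 cats0.
by rewrite -drop_nth // cat_take_drop.
Qed.

(** Inserting [r] at its unique gap is a bijection from the words with content
    [s] and no fixed point in the blocks up to [r] to the words with content
    [r :: s] that have a fixed point in block [r] but none in earlier blocks. *)
Lemma nofix_count_step r s :
  nofix_count r (r :: s) = nofix_count r.+1 (r :: s) + nofix_count r.+1 s.
Proof.
pose F t := insert_at (the_gap r t) r t.
have gapS t : nofix_below r.+1 t -> word_gap r t (the_gap r t).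
  by rewrite nofix_belowS => /andP[_]; apply: the_gapP.
have fixF t : nofix_below r.+1 t -> word_fix r (F t) (the_gap r t).
  by move=> /gapS gt; rewrite word_fix_insert_at //; case/andP: gt.
have perm_F : perm_eq
    [seq t <- permutations (r :: s) | nofix_below r t && has_word_fix r t]
    [seq F t | t <- permutations s & nofix_below r.+1 t].
  apply: uniq_perm.
  - by rewrite filter_uniq // permutations_uniq.
  - rewrite map_inj_in_uniq ?filter_uniq ?permutations_uniq // => t u.
    rewrite !mem_filter => /andP[nt _] /andP[nu _] eqF.
    have eqg := word_fix_inj (fixF t nt); rewrite eqF in eqg.
    have {}eqg := eqg _ (fixF u nu).
    have /andP[le_t _] := gapS t nt; have /andP[le_u _] := gapS u nu.
    by rewrite -(insert_atK r le_t) -(insert_atK r le_u) -/(F t) -/(F u) eqF eqg.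
  move=> t; rewrite mem_filter mem_permutations; apply/idP/mapP.
    case/andP=> /andP[nt /has_word_fixP[x fx]] pt.
    have /and3P[lt_xt /eqP nth_x _] := fx.
    pose u := take x t ++ drop x.+1 t.
    have def_t : insert_at x r u = t by apply: insert_at_remove.
    have le_xu : x <= size u by rewrite -ltnS -(size_insert_at x r) def_t.
    have gx : word_gap r u x by rewrite -word_fix_insert_at // def_t.
    have nu : nofix_below r.+1 u.
      rewrite nofix_belowS -(nofix_below_insert_at gx) def_t nt.
      exact: word_gap_nofix gx.
    exists u; last by rewrite /F (word_gap_inj (gapS u nu) gx).
    rewrite mem_filter nu mem_permutations -(perm_cons r).
    by rewrite -(permPl (perm_insert_at x r u)) def_t.
  case=> u; rewrite mem_filter mem_permutations => /andP[nu pu] ->.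
  rewrite (nofix_below_insert_at (gapS u nu)).
  have -> : has_word_fix r (F u).
    by apply/has_word_fixP; exists (the_gap r u); apply: fixF.
  rewrite (permPl (perm_insert_at _ _ _)) perm_cons pu andbT andbT.
  by move: nu; rewrite nofix_belowS => /andP[].
rewrite /nofix_count -[in LHS]size_filter.
rewrite -(count_predC (has_word_fix r)) !count_filter addnC; congr (_ + _).
  by apply: eq_count => t; rewrite nofix_belowS /= andbC.
rewrite -[RHS]size_filter -(size_map F) -(perm_size perm_F) size_filter.
by apply: eq_count => t; rewrite /= andbC.
Qed.

Lemma nofix_count_notin r s :
  r \notin s -> nofix_count r s = nofix_count r.+1 s.
Proof.
move=> r_s; apply: eq_in_count => t; rewrite mem_permutations => pt.
rewrite nofix_belowS.
case: (has_word_fixP r t) => [[x fx]|]; last by rewrite andbT.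
have := word_fix_bounds fx.
by rewrite /occ (seq.permP pt (pred1 r)) (count_memPn r_s); lia.
Qed.

Lemma nofix_count_perm r s t :
  perm_eq s t -> nofix_count r s = nofix_count r t.
Proof. by move=> /perm_permutations/seq.permP; apply. Qed.

(** * The number of words with a given content *)

Lemma sum_occ k (s : seq nat) : all (gtn k) s -> \sum_(i < k) occ i s = size s.
Proof.
elim: s => [|x s IHs] /=; first by move=> _; rewrite big1.
case/andP=> lt_xk /IHs <-; rewrite big_split /= [LHS]addnC -addn1; congr (_ + _).
rewrite (bigD1 (Ordinal lt_xk)) //= eqxx big1 // => i ne_ix.
apply/eqP; rewrite eqb0 eq_sym.
by apply: contra ne_ix => /eqP eq; apply/eqP/val_inj.
Qed.

Lemma occ_rem x i (s : seq nat) :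
  x \in s -> occ i s = (x == i) + occ i (rem x s).
Proof. by move=> s_x; apply: (seq.permP (perm_to_rem s_x)). Qed.

Lemma prod_fact_rem k x (s : seq nat) : x < k -> x \in s ->
  \prod_(i < k) (occ i s)`! = occ x s * \prod_(i < k) (occ i (rem x s))`!.
Proof.
move=> lt_xk s_x; rewrite (bigD1 (Ordinal lt_xk)) //.
rewrite [in RHS](bigD1 (Ordinal lt_xk)) //= (occ_rem x s_x) eqxx.
rewrite mulnA; congr (_ * _).
apply: eq_bigr => i ne_ix; rewrite (occ_rem i s_x) (_ : x == i = false) //.
by apply: contraNF ne_ix => /eqP eq; apply/eqP/val_inj.
Qed.

(** The multinomial coefficient, obtained by classifying words by first letter. *)
Lemma size_permutations_mul k (s : seq nat) : all (gtn k) s ->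
  size (permutations s) * \prod_(i < k) (occ i s)`! = (size s)`!.
Proof.
have [m] := ubnP (size s); elim: m s => // m IHm s lt_sm s_k.
have [/size0nil->|s_gt0] := posnP (size s).
  by rewrite (eqP (_ : permutations [::] == [:: [::]])) // big1.
rewrite (perm_size (permutationsE s_gt0)) size_allpairs_dep sumnE big_map.
rewrite big_distrl /=.
transitivity (\sum_(x <- undup s) occ x s * (size s).-1`!).
  rewrite [LHS]big_seq [RHS]big_seq; apply: eq_bigr => x; rewrite mem_undup => s_x.
  have lt_xk : x < k by apply: (allP s_k).
  have rem_k : all (gtn k) (rem x s).
    by apply/allP=> y /mem_rem; apply: (allP s_k).
  have lt_rem : size (rem x s) < m by rewrite size_rem // prednK // -ltnS.
  by rewrite (prod_fact_rem lt_xk s_x) mulnCA IHm // size_rem.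
rewrite -big_distrl /=.
case: (size s) s_gt0 (perm_size (perm_count_undup s)) => //= n _.
rewrite size_flatten sumnE !big_map => def_n.
rewrite factS -def_n; congr (_ * _).
by apply: eq_bigr => x _; rewrite size_nseq.
Qed.

(** * Words and descending permutations *)

Lemma card_ord_interval n l m : m <= n ->
  #|[set x : 'I_n | l <= x < m]| = m - l.
Proof.
move=> le_mn; rewrite -[m - l]muln1 -sum_nat_const_nat (big_nat_widen _ _ n) //.
rewrite big_geq_mkord /= -sum1_card; apply: eq_bigl => x.
by rewrite inE andbC.
Qed.

Lemma count_drop_card (p : pred nat) (t : seq nat) n m : size t = n ->
  count p (drop m t) = #|[set u : 'I_n | (m <= u) && p (nth 0 t u)]|.
Proof.
move=> <-; rewrite -sum1_count (big_nth 0) size_drop -sum1_card.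
under eq_bigl => j do rewrite nth_drop addnC.
rewrite -(big_addn 0 (size t) m (fun j => p (nth 0 t j)) (fun=> 1)) big_geq_mkord.
by apply: eq_bigl => x; rewrite inE andbC.
Qed.

Section Blocks.

Variables (k n : nat) (a : 'I_k -> nat).
Hypothesis n_sum : n = \sum_(i < k) a i.

Definition start j := \sum_(l < k | l < j) a l.

Lemma startS (i : 'I_k) : start i.+1 = start i + a i.
Proof.
rewrite /start (bigD1 i) //= addnC; congr (_ + _); apply: eq_bigl => l.
by rewrite ltnS ltn_neqAle andbC.
Qed.

Lemma start_mono j1 j2 : j1 <= j2 -> start j1 <= start j2.
Proof.
move=> le_j; rewrite /start big_mkcond [leqRHS]big_mkcond /=.
by apply: leq_sum => l _; case: ltnP => // lt_l; rewrite (leq_trans lt_l).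
Qed.

Lemma start_leq j : start j <= n.
Proof. by rewrite n_sum /start big_mkcond; apply: leq_sum => l _; case: ifP. Qed.

Lemma mem_block (i : 'I_k) (x : 'I_n) :
  (x \in block n a i) = (start i <= x < start i.+1).
Proof. by rewrite inE. Qed.

Lemma card_block (i : 'I_k) : #|block n a i| = a i.
Proof.
rewrite (card_ord_interval (start i) (start_leq i.+1)) startS; lia.
Qed.

Lemma block_index_exists :
  exists b : 'I_n -> 'I_k, forall i, block n a i = [set x | b x == i].
Proof.
have [b Hb] : exists b : 'I_n -> 'I_k, forall x, x \in block n a (b x).
  apply: (@fin_all_exists _ (fun=> 'I_k) (fun x i => x \in block n a i)) => x.
  (* The block of [x] is the last one to start at or before [x]. *)
  have ex_j : exists j, x < start j.
    exists k; rewrite /start (eq_bigl xpredT) -?n_sum // => l.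
    by rewrite ltn_ord.
  case: (ex_minnP ex_j) => j lt_xj min_j.
  case: j => [|j] in lt_xj min_j.
    by move: lt_xj; rewrite /start big_pred0.
  have le_jx : start j <= x by rewrite leqNgt; apply/negP=> /min_j; rewrite ltnn.
  have [lt_jk|le_kj] := ltnP j k.
    by exists (Ordinal lt_jk); rewrite mem_block /= le_jx.
  have := leq_trans (ltn_ord x) (eq_leq n_sum); rewrite ltnNge => /negP[].
  apply: leq_trans le_jx; rewrite /start [leqRHS](eq_bigl xpredT) // => l.
  by rewrite (leq_trans (ltn_ord l)).
exists b => i; apply/setP=> x; rewrite [RHS]inE; apply/idP/eqP => [|<-//].
have := Hb x; rewrite !mem_block => /andP[le1 lt1] /andP[le2 lt2].
apply/val_inj/eqP; rewrite eqn_leq; apply/andP; split; rewrite leqNgt; apply/negP.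
  by move=> /start_mono le; have := leq_trans lt2 (leq_trans le le1); rewrite ltnn.
by move=> /start_mono le; have := leq_trans lt1 (leq_trans le le2); rewrite ltnn.
Qed.

Variable b : 'I_n -> 'I_k.
Hypothesis block_b : forall i, block n a i = [set x | b x == i].

Lemma b_eqE (i : 'I_k) (x : 'I_n) : (b x == i) = (start i <= x < start i.+1).
Proof. by rewrite -mem_block block_b inE. Qed.

(** The index [v] of the word stands for a value and its letter for the block of
    the position at which [s] takes this value. *)
Definition perm_word (s : 'S_n) : seq nat :=
  [seq val (b ((s^-1)%g v)) | v <- enum 'I_n].

Definition block_word : seq nat := [seq val (b x) | x <- enum 'I_n].

Lemma size_block_word : size block_word = n.
Proof. by rewrite size_map size_enum_ord. Qed.

Lemma size_perm_word s : size (perm_word s) = n.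
Proof. by rewrite size_map size_enum_ord. Qed.

Lemma nth_perm_word s (v : 'I_n) : nth 0 (perm_word s) v = b ((s^-1)%g v).
Proof. by rewrite (nth_map v) ?size_enum_ord // nth_ord_enum. Qed.

Lemma nth_block_word (v : 'I_n) : nth 0 block_word v = b v.
Proof. by rewrite (nth_map v) ?size_enum_ord // nth_ord_enum. Qed.

Lemma perm_word_block_word s : perm_eq (perm_word s) block_word.
Proof.
rewrite /perm_word /block_word (map_comp (fun x => val (b x))) perm_map //.
apply: uniq_perm; first by rewrite map_inj_uniq ?enum_uniq //; apply: perm_inj.
  exact: enum_uniq.
move=> x; rewrite mem_enum; apply/mapP; exists (s x); rewrite ?mem_enum //.
by rewrite permK.
Qed.

Lemma block_word_lt : all (gtn k) block_word.
Proof. by apply/allP=> _ /mapP[x _ ->] /=. Qed.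

Lemma occ_block_word (i : 'I_k) : occ i block_word = a i.
Proof.
rewrite -(card_block i) block_b /occ -[block_word]drop0.
rewrite (count_drop_card _ _ size_block_word); apply: eq_card => x.
by rewrite !inE /= nth_block_word.
Qed.

Lemma occ_lt_block_word (i : 'I_k) : occ_lt i block_word = start i.
Proof.
rewrite /occ_lt -[block_word]drop0 (count_drop_card _ _ size_block_word).
rewrite -[RHS]subn0 -(card_ord_interval 0 (start_leq i)).
apply: eq_card => x; rewrite !inE /= nth_block_word.
have := b_eqE (b x) x; rewrite eqxx => /esym/andP[le_x lt_x].
apply/idP/idP=> [|lt_xi].
  by move=> /start_mono; apply: leq_trans.
rewrite ltnNge; apply/negP=> /start_mono le.
by have := leq_trans lt_xi (leq_trans le le_x); rewrite ltnn.
Qed.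

(** The position at which the descending permutation encoded by [t] takes the
    value [v]. *)
Definition word_pos (t : seq nat) (v : nat) : nat :=
  occ (nth 0 t v) (drop v.+1 t) + occ_lt (nth 0 t v) t.

Definition block_descending (s : 'S_n) : bool :=
  [forall i : 'I_k, forall x in block n a i, forall y in block n a i,
     (val y == (val x).+1) ==> (s y < s x)].

Lemma block_descending_lt s (x y : 'I_n) :
  block_descending s -> b x = b y -> x < y -> s y < s x.
Proof.
move=> desc; move def_m: (y - x.+1) => m.
elim: m => [|m IHm] in y def_m * => eq_b lt_xy.
  move/forallP/(_ (b x))/forall_inP/(_ x): desc; rewrite block_b inE eqxx.
  move=> /(_ isT)/forall_inP/(_ y); rewrite inE eq_b eqxx => /(_ isT)/implyP; apply.
  by rewrite eqn_leq lt_xy -subn_eq0 def_m.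
have lt_zn : y.-1 < n by rewrite (leq_ltn_trans (leq_pred y)).
have := b_eqE (b x) x; rewrite eqxx => /esym bx.
have := b_eqE (b x) y; rewrite eq_b eqxx -eq_b => /esym by_.
have bz : b x = b (Ordinal lt_zn) by apply/esym/eqP; rewrite b_eqE /=; lia.
have lt_xz : x < Ordinal lt_zn by rewrite /=; lia.
have lt_zx : s (Ordinal lt_zn) < s x by apply: IHm => //=; lia.
apply: ltn_trans lt_zx.
move/forallP/(_ (b x))/forall_inP/(_ (Ordinal lt_zn)): desc.
rewrite block_b inE bz eqxx => /(_ isT)/forall_inP/(_ y).
rewrite inE -bz eq_b eqxx => /(_ isT)/implyP; apply.
by rewrite /=; lia.
Qed.

Lemma occ_lt_perm i (t u : seq nat) : perm_eq t u -> occ_lt i t = occ_lt i u.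
Proof. by move=> /seq.permP ptu; apply: ptu. Qed.

Lemma occ_perm i (t u : seq nat) : perm_eq t u -> occ i t = occ i u.
Proof. by move=> /seq.permP ptu; apply: ptu. Qed.

(** Within its block, a position is preceded by exactly the positions with
    larger values, so a descending permutation can be read off its word. *)
Lemma word_pos_perm_word s (v : 'I_n) :
  block_descending s -> word_pos (perm_word s) v = (s^-1)%g v.
Proof.
move=> desc; pose x := (s^-1)%g v; have def_v : v = s x by rewrite permKV.
rewrite /word_pos nth_perm_word -/x.
rewrite (occ_lt_perm _ (perm_word_block_word s)) occ_lt_block_word.
have := b_eqE (b x) x; rewrite eqxx => /esym/andP[le_x lt_x].
rewrite -[RHS](subnK le_x); congr (_ + _).
rewrite -(card_ord_interval _ (ltnW (ltn_ord x))) /occ.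
rewrite (count_drop_card _ _ (size_perm_word s)).
rewrite -[RHS](card_imset _ (@perm_inj _ s)).
apply: eq_card => u; rewrite -(permKV s u); move: ((s^-1)%g u) => y.
rewrite (mem_imset _ _ (@perm_inj _ s)) !inE /= nth_perm_word permK def_v.
apply/andP/andP=> [[lt_s /eqP/val_inj eq_b]|[le_y lt_y]].
  have := b_eqE (b x) y; rewrite eq_b eqxx => /esym/andP[-> _]; split=> //.
  rewrite ltnNge leq_eqVlt; apply/negP=> /orP[/eqP/val_inj eq_xy|lt_xy].
    by move: lt_s; rewrite eq_xy ltnn.
  by have := block_descending_lt desc (esym eq_b) lt_xy; rewrite ltnNge ltnW.
have eq_b : b y = b x by apply/eqP; rewrite b_eqE le_y (ltn_trans lt_y).
by rewrite eq_b (block_descending_lt desc eq_b lt_y).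
Qed.

(** The permutation sought is the inverse of [word_pos t]. *)
Lemma perm_word_surj (t : seq nat) : perm_eq t block_word ->
  exists2 s : 'S_n, block_descending s & perm_word s = t.
Proof.
move=> pt; have size_t : size t = n by rewrite (perm_size pt) size_block_word.
have lt_t (v : 'I_n) : v < size t by rewrite size_t.
have t_lt (v : 'I_n) : nth 0 t v < k.
  by apply: (allP block_word_lt); rewrite -(perm_mem pt) mem_nth ?size_t.
pose l v := Ordinal (t_lt v).
have occ_bound (v : 'I_n) : occ (l v) (drop v.+1 t) < a (l v).
  rewrite -occ_block_word -(occ_perm _ pt) -[t in ltnRHS]drop0.
  apply: leq_trans (leq_occ_drop (l v) t (leq0n v)).
  by rewrite (occ_drop_nth (l v) (lt_t v)) eqxx.
have pos_b (v : 'I_n) : start (l v) <= word_pos t v < start (l v).+1.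
  rewrite /word_pos (occ_lt_perm _ pt) (occ_lt_block_word (l v)) leq_addl startS.
  by rewrite addnC ltn_add2l occ_bound.
have pos_lt (v : 'I_n) : word_pos t v < n.
  by case/andP: (pos_b v) => _ /leq_trans; apply; apply: start_leq.
pose r v := Ordinal (pos_lt v).
have br v : b (r v) = l v by apply/eqP; rewrite b_eqE pos_b.
(* For two indices with the same letter, [word_pos] and the number of later
   occurrences of the letter differ by the same constant. *)
have eq_pos u v : l u = l v -> word_pos t u + occ (l v) (drop v.+1 t)
                             = word_pos t v + occ (l v) (drop u.+1 t).
  by move=> /(congr1 val) /= eq_l; rewrite /word_pos eq_l; lia.
have r_inj : injective r.
  move=> u v eq_r; have eq_l : l u = l v by rewrite -!br eq_r.
  have eq_occ : occ (l v) (drop u.+1 t) = occ (l v) (drop v.+1 t).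
    have eq_w : word_pos t u = word_pos t v by apply: (congr1 val eq_r).
    by have := eq_pos u v eq_l; rewrite eq_w => /addnI.
  apply/val_inj/eqP; rewrite /= eqn_leq.
  apply/andP; split; rewrite leqNgt; apply/negP=> lt.
    have := leq_occ_drop (l v) t lt; rewrite -eq_occ.
    rewrite (occ_drop_nth (l v) (lt_t u)) -[nth 0 t u]/(val (l u)) eq_l eqxx.
    by rewrite ltnn.
  have := leq_occ_drop (l v) t lt; rewrite eq_occ.
  by rewrite (occ_drop_nth (l v) (lt_t v)) eqxx ltnn.
have rE v : ((perm r_inj)^-1^-1)%g v = r v by rewrite invgK permE.
exists (perm r_inj)^-1%g; last first.
  apply: (@eq_from_nth _ 0); rewrite size_perm_word ?size_t // => m lt_mn.
  by rewrite (nth_perm_word _ (Ordinal lt_mn)) rE br.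
apply/forallP=> i; apply/forall_inP=> x xi; apply/forall_inP=> y yi.
apply/implyP=> /eqP def_y; set s := (perm r_inj)^-1%g.
have rs z : r (s z) = z by rewrite -rE permK.
have lx : l (s x) = i by apply/eqP; rewrite -br rs; rewrite block_b inE in xi.
have ly : l (s y) = i by apply/eqP; rewrite -br rs; rewrite block_b inE in yi.
have := eq_pos (s x) (s y); rewrite lx ly => /(_ erefl).
have -> : word_pos t (s x) = x by rewrite -[RHS](congr1 val (rs x)).
have -> : word_pos t (s y) = y by rewrite -[RHS](congr1 val (rs y)).
move=> eq_xy; rewrite ltnNge; apply/negP=> le.
by have := @leq_occ_drop i t (s x).+1 (s y).+1 le; rewrite /= in def_y; lia.
Qed.

Lemma perm_word_nofix s : block_descending s ->
  nofix_below k (perm_word s) = [forall x, s x != x].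
Proof.
move=> desc; apply/allP/forallP=> [nofix x|der j _].
  have := nofix (b x); rewrite mem_iota ltn_ord => /(_ isT).
  apply: contraNN => /eqP sx.
  have sVx : (s^-1)%g x = x by rewrite -[in LHS]sx permK.
  apply/has_word_fixP; exists (val x); rewrite /word_fix size_perm_word ltn_ord.
  have := word_pos_perm_word x desc; rewrite /word_pos nth_perm_word sVx eqxx => ->.
  by rewrite eqxx.
apply/has_word_fixP=> -[m /and3P[]]; rewrite size_perm_word => lt_mn /eqP <-.
rewrite -[m]/(val (Ordinal lt_mn)) -/(word_pos _ _) word_pos_perm_word //.
move=> /eqP/val_inj fm.
by have := der (Ordinal lt_mn); rewrite -{1}fm permKV eqxx.
Qed.

Lemma card_descending_derangement :
  #|[set s : 'S_n | descending_derangement a s]| = nofix_count k block_word.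
Proof.
rewrite cardE -(size_map perm_word) /nofix_count -size_filter; apply: perm_size.
have dd s : s \in enum [set s : 'S_n | descending_derangement a s] =
   block_descending s && nofix_below k (perm_word s).
  rewrite mem_enum inE /descending_derangement -/(block_descending s) andbC.
  by have [/perm_word_nofix->|] := boolP (block_descending s).
apply: uniq_perm.
- rewrite map_inj_in_uniq ?enum_uniq // => s s'; rewrite !dd.
  move=> /andP[ds _] /andP[ds' _] eq_w; apply: invg_inj; apply/permP=> v.
  apply: val_inj.
  by rewrite /= -(word_pos_perm_word v ds) -(word_pos_perm_word v ds') eq_w.
- by rewrite filter_uniq // permutations_uniq.
move=> t; rewrite mem_filter mem_permutations; apply/mapP/andP=> [[s + ->]|[nt pt]].
  by rewrite dd => /andP[_ ->]; split=> //; apply: perm_word_block_word.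
by have [s ds def_t] := perm_word_surj pt; exists s; rewrite // dd ds def_t.
Qed.

End Blocks.

Local Open Scope ring_scope.

(** * Counting words without fixed points *)

(** Writing [X^m] for [m!] makes a factorial of a sum of block sizes
    multiplicative over the blocks; this linear functional undoes it. *)
Definition fact_lin (p : {poly rat}) : rat :=
  \sum_(j < size p) p`_j * (j`!)%:R.

Lemma fact_linE m (p : {poly rat}) :
  (size p <= m)%N -> fact_lin p = \sum_(j < m) p`_j * (j`!)%:R.
Proof.
move=> le_pm; rewrite /fact_lin (big_ord_widen m (fun j => p`_j * (j`!)%:R)) //.
rewrite big_mkcond; apply: eq_bigr => j _; case: ltnP => // le_pj.
by rewrite nth_default ?mul0r.
Qed.

Lemma fact_lin_is_linear : linear (fact_lin : {poly rat} -> rat^o).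
Proof.
move=> c p q; set m := maxn (size p) (size q).
have size_m : (size (c *: p + q)%R <= m)%N.
  rewrite (leq_trans (size_polyD _ _)) // geq_max leq_maxr andbT.
  by rewrite (leq_trans (size_scale_leq _ _)) // leq_maxl.
rewrite (fact_linE size_m) (fact_linE (leq_maxl _ _ : (size p <= m)%N)).
rewrite (fact_linE (leq_maxr _ _ : (size q <= m)%N)) scaler_sumr -big_split /=.
by apply: eq_bigr => j _; rewrite coefD coefZ mulrDl scalerAl.
Qed.

HB.instance Definition _ :=
  GRing.isLinear.Build rat {poly rat} rat^o _ fact_lin fact_lin_is_linear.

Lemma fact_linXn m : fact_lin 'X^m = (m`!)%:R.
Proof.
rewrite /fact_lin size_polyXn big_ord_recr /= coefXn eqxx mul1r big1 ?add0r //.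
by move=> j _; rewrite coefXn ltn_eqF ?mul0r.
Qed.

(** The coefficient of [y^c] in [exp (X y) / (1 + y)]: the numerator stands for
    the choice of all words, and the denominator sieves out a fixed point. *)
Definition desc_poly (c : nat) : {poly rat} :=
  \sum_(j < c.+1) ((-1) ^+ (c - j) / (j`!)%:R) *: 'X^j.

Lemma desc_poly0 : desc_poly 0 = 1.
Proof. by rewrite /desc_poly big_ord1 invr1 mulr1 scale1r. Qed.

Lemma desc_polyS c :
  desc_poly c.+1 = ((c.+1)`!)%:R^-1 *: 'X^(c.+1) - desc_poly c.
Proof.
rewrite /desc_poly big_ord_recr /= subnn expr0 mul1r addrC; congr (_ + _).
rewrite -sumrN; apply: eq_bigr => j _; rewrite -scaleNr -mulNr.
by rewrite subSn ?exprS ?mulN1r // -ltnS.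
Qed.

(** The factor of a block [i]: fixed points are forbidden in the blocks below
    [r] and unconstrained in the others. *)
Definition mixed_poly (r i c : nat) : {poly rat} :=
  if (i < r)%N then desc_poly c else (c`!)%:R^-1 *: 'X^c.

(** Both sides satisfy the recurrence [nofix_count_step], and for [r = 0] they
    are multinomial coefficients. *)
Lemma nofix_countE k r (s : seq nat) : (r <= k)%N -> all (gtn k) s ->
  (nofix_count r s)%:R = fact_lin (\prod_(i < k) mixed_poly r i (occ i s)).
Proof.
elim: r s => [|r IHr] s lt_rk s_k.
  rewrite (eq_bigr (fun i : 'I_k => ((occ i s)`!)%:R^-1 *: 'X^(occ i s))) //.
  rewrite scaler_prod prodrXr linearZ /= fact_linXn sum_occ // prodfV.
  rewrite -(size_permutations_mul s_k) natrM natr_prod mulrC.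
  rewrite [RHS](_ : _ = (size (permutations s))%:R).
    by rewrite /nofix_count (eq_count (_ : _ =1 predT)) ?count_predT.
  rewrite /GRing.scale /= mulrA mulVf ?mul1r //.
  by apply/prodf_neq0 => i _; rewrite Num.Theory.pnatr_eq0 -lt0n fact_gt0.
have [c] := ubnP (occ r s); elim: c s s_k => // c IHc s s_k lt_c.
have [s_r|s_r] := boolP (r \in s); last first.
  rewrite -(nofix_count_notin s_r) IHr ?(ltnW lt_rk) //; congr fact_lin.
  apply: eq_bigr => i _; rewrite /mixed_poly ltnS.
  case: ltngtP => // ->; rewrite /occ (count_memPn s_r).
  by rewrite desc_poly0 invr1 scale1r.
have rem_k : all (gtn k) (rem r s).
  by apply/allP=> y /mem_rem; apply: (allP s_k).
have ps := perm_to_rem s_r.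
have occ_r : occ r s = (occ r (rem r s)).+1 by rewrite (occ_rem r s_r) eqxx.
have: (nofix_count r s)%:R =
      (nofix_count r.+1 s)%:R + (nofix_count r.+1 (rem r s))%:R :> rat.
  by rewrite -natrD !(nofix_count_perm _ ps) nofix_count_step.
move=> /(canLR (addrK _)) <-.
have lt_rem : (occ r (rem r s) < c)%N by rewrite -ltnS -occ_r.
rewrite (IHc _ rem_k lt_rem) IHr ?(ltnW lt_rk) // -linearB /=; congr fact_lin.
(* The two sides now differ in the factor of block [r] only. *)
rewrite [X in X - _](bigD1 (Ordinal lt_rk)) //=.
rewrite [X in _ - X](bigD1 (Ordinal lt_rk)) //= [RHS](bigD1 (Ordinal lt_rk)) //=.
rewrite {1 3 5}/mixed_poly ltnn ltnSn occ_r desc_polyS.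
rewrite mulrBl; congr (_ * _ - _ * _); apply: eq_bigr => i ne_ir.
  rewrite /mixed_poly ltnS [(i <= r)%N]leq_eqVlt (_ : i == r :> nat = false) //.
  by apply: contraNF ne_ir => /eqP eq; apply/eqP/val_inj.
rewrite (occ_rem i s_r) (_ : r == i = false) //.
by apply: contraNF ne_ir => /eqP eq; apply/eqP/val_inj.
Qed.

(** * Permutations by fixed points *)

Lemma sum_subsets_card (V : nmodType) (T : finType) (B : {set T})
    (g : nat -> V) :
  \sum_(U : {set T} | U \subset B) g #|U| =
  \sum_(j < #|B|.+1) g j *+ 'C(#|B|, j).
Proof.
rewrite (partition_big (fun U : {set T} => inord #|U| : 'I_#|B|.+1) xpredT) //=.
apply: eq_bigr => j _; rewrite -cards_draws -sumr_const; apply: eq_big => U.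
  rewrite inE; have [sUB|] //= := boolP (U \subset B).
  by rewrite -val_eqE /= inordK // ltnS subset_leq_card.
by case/andP=> sUB /eqP <-; rewrite inordK // ltnS subset_leq_card.
Qed.

(** Binomial expansion of [(1 + (X - 1))^|F|]. *)
Lemma polyX_subsets (R : nzRingType) (T : finType) (F : {set T}) :
  'X^#|F| = \sum_(U : {set T} | U \subset F) ('X - 1) ^+ #|U| :> {poly R}.
Proof.
rewrite (sum_subsets_card F (fun j => ('X - 1 : {poly R}) ^+ j)).
rewrite -[in LHS](subrK 1 'X) addrC exprDn_comm; last exact/commr_sym/commr1.
by apply: eq_bigr => j _; rewrite expr1n mul1r.
Qed.

Lemma perm_on_fixing (T : finType) (B U : {set T}) (s : {perm T}) :
  U \subset B ->
  perm_on B s && (U \subset [set x in B | s x == x]) = perm_on (B :\: U) s.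
Proof.
move=> sUB; apply/andP/idP=> [[sB /subsetP sU]|sBU].
  apply/subsetP=> x; rewrite !inE => nx; have := subsetP sB x nx => ->.
  by rewrite andbT; apply/negP=> /sU; rewrite inE (negPf nx) andbF.
split; first by apply: subset_trans sBU (subsetDl _ _).
apply/subsetP=> x Ux; rewrite inE (subsetP sUB) //=.
by apply/eqP/(out_perm sBU); rewrite inE Ux.
Qed.

(** Expanding [X^fix] over the subsets [U] of the fixed points leaves, for each
    [U], the permutations of [B :\: U].  The value depends on [#|B|] only, which
    is what makes it possible to compare different sets and types. *)
Lemma sum_perm_on_fix (T : finType) (B : {set T}) :
  \sum_(s : {perm T} | perm_on B s) 'X^#|[set x in B | s x == x]| =
  \sum_(j < #|B|.+1)
    (('X - 1) ^+ j *+ (#|B| - j)`!) *+ 'C(#|B|, j) :> {poly rat}.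
Proof.
rewrite -(sum_subsets_card B
  (fun j => ('X - 1 : {poly rat}) ^+ j *+ (#|B| - j)`!)).
under eq_bigr do rewrite polyX_subsets.
rewrite (exchange_big_dep (fun U : {set T} => U \subset B)) /=; last first.
  move=> s U _ /subset_trans; apply.
  by apply/subsetP=> x; rewrite inE => /andP[].
apply: eq_bigr => U sUB; rewrite (eq_bigl _ _ (fun s => perm_on_fixing s sUB)).
by rewrite sumr_const card_perm cardsD (setIidPr sUB).
Qed.

Lemma f_lambda_sum m :
  f_lambda m = \sum_(s : 'S_m) 'X^#|fixpts s|.
Proof.
rewrite /f_lambda poly_def.
under eq_bigr => j _ do rewrite cardsE -sumr_const scaler_suml.
rewrite (exchange_big_dep predT) //=; apply: eq_bigr => s _.
have lt_fix : (#|fixpts s| < m.+1)%N by rewrite ltnS -[leqRHS]card_ord max_card.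
rewrite (big_pred1 (Ordinal lt_fix)) ?scale1r // => j.
by rewrite /= eq_sym.
Qed.

Lemma f_lambda_perm_on (T : finType) (B : {set T}) :
  f_lambda #|B| =
  \sum_(s : {perm T} | perm_on B s) 'X^#|[set x in B | s x == x]|.
Proof.
rewrite f_lambda_sum sum_perm_on_fix; set m := #|B|.
have := sum_perm_on_fix [set: 'I_m]; rewrite cardsT card_ord => <-.
apply: eq_big => [s|s _]; first by apply/esym/subsetP=> x; rewrite inE.
by congr ('X^ #|pred_of_set _|); apply/setP=> x; rewrite !inE.
Qed.

Lemma f_lambda_at1 m : (f_lambda m).[1] = (m`!)%:R.
Proof.
rewrite f_lambda_sum horner_sum (eq_bigr (fun=> 1)) ?sumr_const ?card_Sn //.
by move=> s _; rewrite hornerXn expr1n.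
Qed.

Section Glue.

Variables (T I : finType) (c : T -> I).
Implicit Types (s : {perm T}) (F : {ffun I -> {perm T}}).

Let cls i := [set x | c x == i].

Definition color_stable s := [forall x, c (s x) == c x].

(** The function is injective when each [F i] preserves its colour class; the
    default [1] covers the other families. *)
Definition glue F : {perm T} := insubd (1%g : {perm T}) [ffun x => F (c x) x].

Lemma glueE F x : (forall i, perm_on (cls i) (F i)) -> glue F x = F (c x) x.
Proof.
move=> F_on; rewrite -pvalE.
have cF y : c (F (c y) y) = c y.
  by apply/eqP; have := perm_closed y (F_on (c y)); rewrite !inE eqxx.
have -> : pval (glue F) = [ffun x => F (c x) x]; last by rewrite ffunE.
apply: insubdK; apply/injectiveP=> y z; rewrite !ffunE => eqF.
have := congr1 c eqF; rewrite !cF => eq_c.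
by move: eqF; rewrite eq_c => /perm_inj.
Qed.

(** A colour-preserving permutation is the same as a permutation of each colour
    class, and its fixed points are those of the pieces. *)
Lemma prod_f_lambda_color :
  \prod_i f_lambda #|cls i| =
  \sum_(s | color_stable s) 'X^#|[set x | s x == x]|.
Proof.
under eq_bigr => i _ do rewrite f_lambda_perm_on.
rewrite bigA_distr_big_dep /=.
pose split s := [ffun i => restr_perm (cls i) s].
have split_on s i : perm_on (cls i) (split s i) by rewrite ffunE restr_perm_on.
have splitE s x : color_stable s -> split s (c x) x = s x.
  move=> /forallP cs; rewrite ffunE restr_permE //; last by rewrite inE.
  by apply/astabsP=> y; rewrite !inE /= (eqP (cs y)).
rewrite (reindex_onto split glue) => [|F /familyP F_on]; last first.
  apply/ffunP=> i; apply/permP=> x.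
  have cs : color_stable (glue F).
    apply/forallP=> y; rewrite glueE //.
    by have := perm_closed y (F_on (c y)); rewrite !inE eqxx.
  have [<-|ne_i] := eqVneq (c x) i; first by rewrite splitE // glueE.
  by rewrite (out_perm (split_on _ i)) ?(out_perm (F_on i)) // inE.
have sel s : (split s \in family (fun i => perm_on (cls i)))
             && (glue (split s) == s) = color_stable s.
  have -> : split s \in family (fun i => perm_on (cls i)).
    by apply/familyP=> i; apply: split_on.
  rewrite /=; apply/eqP/idP=> [<-|cs]; last first.
    by apply/permP=> x; rewrite glueE // splitE.
  apply/forallP=> y; rewrite glueE //.
  by have := perm_closed y (split_on s (c y)); rewrite !inE eqxx.
apply: eq_big => s; first exact: sel.
rewrite sel => cs; rewrite prodrXr; congr ('X^_).
rewrite -[RHS]sum1_card (partition_big c predT) //=; apply: eq_bigr => i _.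
rewrite sum1_card; apply: eq_card => x; rewrite !inE andbC [RHS]unfold_in /= inE.
by have [<-|] := eqVneq (c x) i; rewrite ?andbF // splitE.
Qed.

End Glue.

Lemma prod_1D_subsets (R : comNzRingType) (I : finType) (S : {set I})
    (w : I -> R) :
  \prod_(C in S) (1 + w C) =
  \sum_(V : {set I} | V \subset S) \prod_(C in V) w C.
Proof.
rewrite big_mkcond.
rewrite (eq_bigr (fun C => (if C \in S then w C else 0) + 1)) /=; last first.
  by move=> C _; case: ifP; rewrite ?add0r // addrC.
rewrite bigA_distr /= (bigID (fun V : {set I} => V \subset S)) /= [X in _ + X]big1.
  rewrite addr0; apply: eq_bigr => V sVS; rewrite [RHS]big_mkcond /=.
  by apply: eq_bigr => C _; case: ifP => // VC; rewrite (subsetP sVS).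
move=> V /subsetPn[C VC nSC]; rewrite (bigD1 C) //= VC (negPf nSC) mul0r //.
Qed.

Section SmallCycles.

Variables (T I : finType) (c : T -> I) (s : {perm T}).

Let small := [set C in porbits s | [exists i, C \subset [set x | c x == i]]].

(** The classes of this colouring are the complement of [U] and the traces on
    [U] of the classes of [c]. *)
Definition color_in (U : {set T}) (x : T) : option I :=
  if x \in U then Some (c x) else None.

Let stable_in (U : {set T}) := color_stable (color_in U) s.

Lemma porbits_eq C x : C \in porbits s -> x \in C -> C = porbit s x.
Proof. by case/imsetP=> y _ ->; rewrite -eq_porbit_mem => /eqP. Qed.

Lemma stable_inP (U : {set T}) : reflect
  (forall x, (s x \in U) = (x \in U) /\ (x \in U -> c (s x) = c x)) (stable_in U).
Proof.
apply: (iffP forallP) => H x.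
  have /eqP := H x; rewrite /color_in.
  by case: (s x \in U); case: (x \in U) => // -[->].
have [e1 e2] := H x; rewrite /color_in e1.
by case: (boolP (x \in U)) e2 => // xU ->.
Qed.

Lemma small_porbit_in U x : stable_in U -> x \in U ->
  porbit s x \in [set C in small | C \subset U].
Proof.
move=> /stable_inP stU Ux.
have step i : ((s ^+ i)%g x \in U) /\ c ((s ^+ i)%g x) = c x.
  elim: i => [|i [Ui ci]]; first by rewrite expg0 perm1.
  by rewrite expgSr permM; have [-> /(_ Ui) ->] := stU ((s ^+ i)%g x).
rewrite !inE imset_f //=; apply/andP; split.
  apply/existsP; exists (c x); apply/subsetP=> y /porbitP[i ->].
  by rewrite inE; case: (step i) => _ ->.
by apply/subsetP=> y /porbitP[i ->]; case: (step i).
Qed.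

Lemma small_trivIset (V : {set {set T}}) : V \subset small -> trivIset V.
Proof.
move=> sV; apply/trivIsetP=> C D /(subsetP sV) + /(subsetP sV).
rewrite !inE => /andP[pC _] /andP[pD _]; apply: contraR.
move=> /pred0Pn[x /= /andP[Cx Dx]].
by rewrite (porbits_eq pC Cx) (porbits_eq pD Dx).
Qed.

Lemma stable_in_cover (V : {set {set T}}) :
  V \subset small -> stable_in (cover V).
Proof.
move=> sV; apply/stable_inP=> x.
have memV C y : C \in V -> (s y \in C) = (y \in C).
  move=> /(subsetP sV); rewrite inE => /andP[/imsetP[z _ ->] _].
  by rewrite -!eq_porbit_mem -{2}[s]expg1 porbit_perm.
split=> [|/bigcupP[C CV Cx]].
  by apply/bigcupP/bigcupP=> -[C CV]; exists C; rewrite // ?memV // -(memV C).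
have := subsetP sV C CV; rewrite inE => /andP[_ /existsP[i /subsetP sCi]].
have := sCi x Cx; have := sCi (s x); rewrite memV // !inE.
by move=> /(_ Cx)/eqP -> /eqP ->.
Qed.

(** The sets [U] such that [s] preserves [color_in U] are the unions of small
    cycles, and a union determines the cycles in it. *)
Lemma sum_stable_in (R : comNzRingType) :
  \sum_(U | stable_in U) (-1) ^+ #|U| =
  \prod_(C in small) (1 + (-1) ^+ #|C|) :> R.
Proof.
rewrite prod_1D_subsets.
rewrite (reindex_onto cover (fun U => [set C in small | C \subset U])) /=.
  have sel V : stable_in (cover V)
               && ([set C in small | C \subset cover V] == V)
             = (V \subset small).
    apply/andP/idP=> [[_ /eqP <-]|sV].
      by apply/subsetP=> C; rewrite inE => /andP[].
    split; first exact: stable_in_cover.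
    apply/eqP/setP=> C; rewrite inE.
    apply/andP/idP=> [[sC /subsetP CV]|CV]; last first.
      by rewrite (subsetP sV) // (bigcup_max C).
    have pC : C \in porbits s by move: sC; rewrite inE => /andP[].
    have /imsetP[x _ defC] := pC.
    have Cx : x \in C by rewrite defC porbit_id.
    have /bigcupP[D DV Dx] := CV x Cx.
    have := subsetP sV D DV; rewrite inE => /andP[pD _].
    by rewrite (porbits_eq pC Cx) -(porbits_eq pD Dx).
  apply: eq_big => V; first exact: sel.
  rewrite sel => sV; rewrite prodrXr; congr (_ ^+ _).
  by have /eqP <- := small_trivIset sV.
move=> U stU; apply/eqP; rewrite eqEsubset; apply/andP; split.
  by apply/bigcupsP=> C; rewrite inE => /andP[].
apply/subsetP=> x Ux; apply/bigcupP; exists (porbit s x); last exact: porbit_id.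
exact: small_porbit_in.
Qed.

End SmallCycles.

(** Both sides count pairs of a set [U] and a permutation preserving [color_in
    U], with sign [(-1)^|U|] and by fixed points. *)
Lemma sum_sets_f_lambda (T I : finType) (c : T -> I) :
  \sum_(U : {set T})
     (-1) ^+ #|U| * f_lambda #|~: U|
       * \prod_i f_lambda #|[set x | c x == i] :&: U| =
  \sum_(s : {perm T}) 'X^#|[set x | s x == x]| *
     \prod_(C in [set C in porbits s |
                    [exists i, C \subset [set x | c x == i]]])
       (1 + (-1) ^+ #|C|).
Proof.
under [RHS]eq_bigr => s _ do rewrite -sum_stable_in mulr_sumr.
rewrite (exchange_big_dep predT) //=; apply: eq_bigr => U _.
rewrite -mulr_suml [RHS]mulrC -prod_f_lambda_color (bigD1 None) //=.
rewrite -[LHS]mulrA; congr (_ * _); congr (_ * _).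
  congr (f_lambda _).
  by apply: eq_card => x; rewrite !inE /color_in; case: (x \in U).
rewrite [RHS](reindex_omap Some id) => [|[]//] /=.
apply: eq_big => [i|i _]; first by rewrite eqxx.
congr (f_lambda _); apply: eq_card => x; rewrite !inE /color_in andbC.
by case: (x \in U).
Qed.

(** * The signed sum over subsets *)

(** A set is the same as the family of its traces on the classes of [c]. *)
Lemma sum_sets_prod (R : comNzRingType) (T I : finType) (c : T -> I)
    (G : I -> {set T} -> R) :
  \sum_(U : {set T}) \prod_i G i ([set x | c x == i] :&: U) =
  \prod_i \sum_(U : {set T} | U \subset [set x | c x == i]) G i U.
Proof.
set cls := fun i => [set x | c x == i].
rewrite bigA_distr_big_dep /=.
rewrite (reindex_onto (fun U => [ffun i => cls i :&: U])
                      (fun F : {ffun I -> {set T}} => \bigcup_i F i)) /=.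
  apply: eq_big => [U|U _]; last by apply: eq_bigr => i _; rewrite ffunE.
  apply/esym/andP; split.
    by apply/familyP=> i; rewrite ffunE unfold_in subsetIl.
  apply/eqP/setP=> x; apply/bigcupP/idP=> [[i _]|Ux].
    by rewrite ffunE inE => /andP[].
  by exists (c x); rewrite // ffunE !inE eqxx.
move=> F /familyP FS; apply/ffunP=> i; rewrite ffunE; apply/setP=> x; rewrite !inE.
apply/andP/idP=> [[/eqP <- /bigcupP[j _ Fjx]]|Fix].
  by have := subsetP (FS j) x Fjx; rewrite inE => /eqP ->.
have := subsetP (FS i) x Fix; rewrite inE => ->; split=> //.
by apply/bigcupP; exists i.
Qed.

Lemma sum_subsets_desc_poly (T : finType) (A : {set T}) :
  \sum_(U : {set T} | U \subset A)
     ((-1) ^+ #|U| * (#|U|`!)%:R) *: 'X^(#|A| - #|U|) =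
  (#|A|`!)%:R *: desc_poly #|A|.
Proof.
rewrite (sum_subsets_card A
  (fun j => ((-1) ^+ j * (j`!)%:R : rat) *: ('X^(#|A| - j) : {poly rat}))).
rewrite /desc_poly (reindex_inj rev_ord_inj) scaler_sumr; apply: eq_bigr => j _.
have le_jA : (j <= #|A|)%N by rewrite -ltnS.
rewrite /= subSS subKn // scalerMnl scalerA; congr (_ *: _).
have nz_j : (j`!)%:R != 0 :> rat by rewrite Num.Theory.pnatr_eq0 -lt0n fact_gt0.
rewrite -mulr_natr bin_sub // -(bin_fact le_jA) !natrM.
move: ((-1) ^+ _) (_`!)%:R ('C(_, _))%:R (_`!)%:R nz_j => e u v w nz_w.
by field.
Qed.

Section Main.

Variables (k n : nat) (a : 'I_k -> nat).
Hypothesis n_sum : n = (\sum_(i < k) a i)%N.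
Variable b : 'I_n -> 'I_k.
Hypothesis block_b : forall i, block n a i = [set x | b x == i].

(** Without odd small cycles there are no fixed points, since the singleton of a
    fixed point would be one; then every factor is [2]. *)
Lemma small_weightE (s : 'S_n) :
  'X^#|[set x | s x == x]| * \prod_(C in small_cycles a s) (1 + (-1) ^+ #|C|)
  = (cweight a s)%:R%:P :> {poly rat}.
Proof.
rewrite /cweight; case: ifP => [/exists_inP[C sC oddC]|/negbT].
  by rewrite (bigD1 C) //= -signr_odd oddC expr1 subrr mul0r mulr0.
rewrite negb_exists_in => /forall_inP even_small.
rewrite (eq_card0 (_ : [set x | s x == x] =i pred0)) => [|x].
  rewrite expr0 mul1r (eq_bigr (fun=> 2%:R)) => [|C /even_small evC].
    by rewrite prodr_const -natrX polyC_natr.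
  by rewrite -signr_odd (negPf evC) expr0.
rewrite !inE; apply/negP=> /eqP sx.
have orb_x : porbit s x = [set x].
  apply/setP=> y; rewrite inE; apply/porbitP/eqP=> [[m ->]|->].
    by elim: m => [|m IHm]; rewrite ?expg0 ?perm1 // expgS permM sx.
  by exists 0%N; rewrite expg0 perm1.
have /even_small : [set x] \in small_cycles a s.
  rewrite inE -{1}orb_x imset_f //=; apply/existsP; exists (b x).
  by rewrite sub1set block_b inE.
by rewrite cards1.
Qed.

Lemma signed_sum_cweight :
  \sum_(T : {set 'I_n})
    (-1) ^+ #|T| * f_lambda #|~: T|
      * \prod_(i < k) f_lambda #|block n a i :&: T| =
  (\sum_(s : 'S_n) (cweight a s)%:R)%:P.
Proof.
under eq_bigr => T _ do under eq_bigr => i _ do rewrite block_b.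
rewrite sum_sets_f_lambda rmorph_sum /=; apply: eq_bigr => s _.
rewrite -small_weightE; congr (_ * _); apply: eq_bigl => C.
by rewrite !inE; congr (_ && _); apply: eq_existsb => i; rewrite block_b.
Qed.

(** At [X = 1] each summand is [fact_lin] of a product over the blocks, because
    [#|~: T|] is the degree of the product of the [X^(a_i - |A_i :&: T|)]. *)
Lemma sum_cweight_fact_lin :
  \sum_(s : 'S_n) (cweight a s)%:R =
  (\prod_(i < k) ((a i)`!)%:R)
    * fact_lin (\prod_(i < k) desc_poly (a i)) :> rat.
Proof.
rewrite -[LHS](hornerC _ 1) -signed_sum_cweight horner_sum.
pose G i (U : {set 'I_n}) : {poly rat} :=
  ((-1) ^+ #|U| * (#|U|`!)%:R) *: 'X^(#|[set x | b x == i]| - #|U|).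
transitivity
  (fact_lin (\sum_(U : {set 'I_n}) \prod_i G i ([set x | b x == i] :&: U))).
  rewrite linear_sum; apply: eq_bigr => U _ /=.
  rewrite /G scaler_prod prodrXr linearZ /= fact_linXn big_split /= prodrXr.
  have card_split (W : {set 'I_n}) :
      (\sum_i #|[set x | b x == i] :&: W| = #|W|)%N.
    rewrite -[RHS]sum1_card (partition_big b xpredT) //=; apply: eq_bigr => i _.
    by rewrite -sum1_card; apply: eq_bigl => x; rewrite !inE andbC.
  rewrite card_split -(card_split (~: U)).
  rewrite !hornerM horner_exp hornerN hornerC f_lambda_at1 horner_prod.
  rewrite card_split.
  rewrite (eq_bigr (fun i => #|[set x | b x == i] :&: ~: U|)); last first.
    by move=> i _; rewrite -(cardsID U [set x | b x == i]) setDE addKn.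
  rewrite card_split /GRing.scale /= mulrAC; congr (_ * _ * _).
  by apply: eq_bigr => i _; rewrite f_lambda_at1 block_b.
rewrite sum_sets_prod; under eq_bigr => i _ do rewrite sum_subsets_desc_poly.
rewrite scaler_prod linearZ /=; congr (_ * fact_lin _).
  by apply: eq_bigr => i _; rewrite -block_b card_block.
by apply: eq_bigr => i _; rewrite -block_b card_block.
Qed.

Lemma card_descending_fact_lin :
  (#|[set s : 'S_n | descending_derangement a s]|)%:R =
  fact_lin (\prod_(i < k) desc_poly (a i)).
Proof.
rewrite (card_descending_derangement n_sum block_b) (@nofix_countE k) //.
  congr fact_lin; apply: eq_bigr => i _.
  by rewrite /mixed_poly ltn_ord (occ_block_word n_sum block_b).
exact: block_word_lt.
Qed.

End Main.

Theorem proposition4p1 (k n : nat) (a : 'I_k -> nat) (k_ge1 : (1 <= k)%N)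
    (n_sum : n = (\sum_(i < k) a i)%N) :
  let lhs : {poly rat} :=
    (\prod_(i < k) ((a i)`!)%:R)^-1 *:
      \sum_(T : {set 'I_n})
        (-1) ^+ #|T| * f_lambda #|~: T|
          * \prod_(i < k) f_lambda #|block n a i :&: T| in
  let rhs : rat :=
    (\prod_(i < k) ((a i)`!)%:R)^-1 * \sum_(s : 'S_n) (cweight a s)%:R in
  [/\ lhs = rhs%:P,
      exists c : rat, lhs = c%:P
    & rhs = (#|[set s : 'S_n | descending_derangement a s]|)%:R].
Proof.
move=> lhs rhs; have [b block_b] := block_index_exists n_sum.
have lhs_rhs : lhs = rhs%:P.
  by rewrite /lhs (signed_sum_cweight block_b) /rhs polyCM mul_polyC.
split=> //; first by exists rhs.
rewrite /rhs (sum_cweight_fact_lin n_sum block_b) mulrA mulVf ?mul1r.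
  by rewrite (card_descending_fact_lin n_sum block_b).
by apply/prodf_neq0 => i _; rewrite Num.Theory.pnatr_eq0 -lt0n fact_gt0.
Qed.
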